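(* Let $A:\mathcal{H}_1\to\mathcal{H}_2$ be a nonzero bounded linear operator between real Hilbert spaces. Let $S:\mathcal{H}_1\to\mathcal{H}_1$ and $T:\mathcal{H}_2\to\mathcal{H}_2$ be $\rho_S$-SQNE and $\rho_T$-SQNE, respectively, where $\rho_S,\rho_T>0$. Let the sequence $\{x_k\}_{k=0}^\infty$ be defined by $$x_0\in\mathcal{H}_1;\qquad x_{k+1}:=S\left(x_k+\lambda_k\frac{\sigma(x_k)}{\|A\|^2}A^*\big(T(Ax_k)-Ax_k\big)\right),\quad k=0,1,2,\ldots,$$ where the relaxation parameters satisfy $\lambda_k\in[\varepsilon,1]$ for some $\varepsilon\in(0,1)$ and the extrapolation function $\sigma:\mathcal{H}_1\to[1,\infty)$ is bounded from above by the function $\tau$ given by $$\tau(x):=\begin{cases}\left(\dfrac{\|A\|\cdot\|T(Ax)-Ax\|}{\|A^*(T(Ax)-Ax)\|}\right)^2, & \text{if }Ax\notin\operatorname{Fix}T,\\ 1,&\text{if }Ax\in\operatorname{Fix}T\end{cases}$$ (in particular, one can use $\sigma(x):=1$ or $\sigma(x):=\tau(x)$ for all $x$). Assume that $F:=\operatorname{Fix}S\cap A^{-1}(\operatorname{Fix}T)\neq\emptyset$. Then the following statements hold. (i) If $S$ and $T$ are both weakly regular, then $\{x_k\}_{k=0}^\infty$ converges weakly to some $x_\infty\in F$. (ii) If $\operatorname{im}A$ is closed, $S$ and $T$ are both boundedly regular, and the two families of sets $\{\operatorname{im}A,\operatorname{Fix}T\}$ and $\{\operatorname{Fix}S,A^{-1}(\operatorname{Fix}T)\}$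 are boundedly regular, then the convergence to $x_\infty$ is in norm. (iii) If $\operatorname{im}A$ is closed, $S$ and $T$ are both boundedly linearly regular, and the two families of sets $\{\operatorname{im}A,\operatorname{Fix}T\}$ and $\{\operatorname{Fix}S,A^{-1}(\operatorname{Fix}T)\}$ are boundedly linearly regular, then the convergence to $x_\infty$ is at least linear, that is, for all $k$, $$d(x_{k+1},F)\le q\,d(x_k,F)\quad\text{and}\quad\|x_k-x_\infty\|\le 2d(x_0,F)q^k$$ for some $q\in(0,1)$, which may depend on $x_0$.
   Context: $\mathcal{H}_1,\mathcal{H}_2$ are real Hilbert spaces; $A^*$ is the adjoint of $A$, $\operatorname{im}A$ its image, $\|A\|$ its operator norm. $\operatorname{Fix}T$ is the fixed point set of $T$, $d(x,C)=\inf_{c\in C}\|x-c\|$, and $\rightharpoonup$ denotes weak convergence. (Under the hypotheses, $A^*(T(Ax)-Ax)=0$ if and only if $Ax\in\operatorname{Fix}T$, and $\tau\ge1$, so $\tau$ is well defined with values in $[1,\infty)$.) $\rho$-SQNE ($\rho$-strongly quasi-nonexpansive, $\rho\ge 0$): $U$ (not necessarily linear) has $\operatorname{Fix}U\ne\emptyset$ and $\|Ux-z\|^2\le\|x-z\|^2-\rho\|Ux-x\|^2$ for all $x$ and all $z\in\operatorname{Fix}U$. Regular operators. An operator $U$ on a Hilbert space $\mathcal{H}$ with $\operatorname{Fix}U\neq\emptyset$ is: - weakly regular if for any sequence $\{x_k\}\subseteq\mathcal{H}$ and any $x_\infty\in\mathcal{H}$, whenever a subsequence $x_{n_k}\rightharpoonup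 x_\infty$ and $Ux_k-x_k\to0$ then $x_\infty\in\operatorname{Fix}U$; - boundedly regular if for every bounded sequence $\{x_k\}$, $\|Ux_k-x_k\|\to0$ implies $d(x_k,\operatorname{Fix}U)\to0$; - boundedly linearly regular if for every bounded set $B\subseteq\mathcal{H}$ there is $\delta_B>0$ with $\|Ux-x\|\ge\delta_B\,d(x,\operatorname{Fix}U)$ for every $x\in B$. Regular families of sets. A family $\{C_1,\dots,C_m\}$ of closed convex sets with $C:=\bigcap_iC_i\neq\emptyset$ is: - boundedly regular if for every bounded sequence $\{x_k\}$, $\max_i d(x_k,C_i)\to0$ implies $d(x_k,C)\to0$; - boundedly linearly regular if for every bounded set $B$ there is $\kappa_B>0$ with $d(x,C)\le\kappa_B\max_i d(x,C_i)$ for every $x\in B$. *)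

(* Defs.v *)
From HB Require Import structures.
From mathcomp Require Import all_boot all_order all_algebra.
From mathcomp Require Import all_classical all_reals all_analysis.

Set Implicit Arguments.
Unset Strict Implicit.
Unset Printing Implicit Defensive.

Import Order.TTheory GRing.Theory Num.Theory.
Import numFieldNormedType.Exports.

Local Open Scope classical_set_scope.
Local Open Scope ring_scope.

HB.mixin Record CompleteNormedModule_isHilbert (R : realType) H
    of CompleteNormedModule R H := {
  inner : H -> H -> R;
  innerC : forall x y, inner x y = inner y x;
  innerDl : forall x y z, inner (x + y) z = inner x z + inner y z;
  innerZl : forall (a : R) x y, inner (a *: x) y = a * inner x y;
  inner_norm : forall x, inner x x = `|x| ^+ 2
}.

#[short(type="hilbertType")]
HB.structure Definition Hilbert (R : realType) :=
  {H of CompleteNormedModule R H & CompleteNormedModule_isHilbert R H}.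

Definition weakly_cvg (R : realType) (H : hilbertType R) (x : nat -> H)
    (l : H) : Prop :=
  forall y : H, (fun k => inner (x k) y) @ \oo --> inner l y.

(* Only used for nonempty [C]; otherwise it is 0 by convention of [inf]. *)
Definition dist (R : realType) (H : hilbertType R) (x : H) (C : set H) : R :=
  inf [set `|x - c| | c in C].

Definition Fix (T : Type) (U : T -> T) : set T := [set x | U x = x].

Definition opnorm (R : realType) (H1 H2 : hilbertType R)
    (A : {linear H1 -> H2}) : R :=
  sup [set `|A x| | x in [set x | `|x| <= 1]].

(* For bounded [A] the set below is a singleton by the Riesz representation
   theorem; the default value 0 is irrelevant. *)
Definition adjoint (R : realType) (H1 H2 : hilbertType R)
    (A : {linear H1 -> H2}) (y : H2) : H1 :=
  xget 0 [set z | forall x, inner (A x) y = inner x z].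

Definition SQNE (R : realType) (H : hilbertType R) (rho : R) (U : H -> H)
    : Prop :=
  Fix U !=set0 /\
  forall x z, Fix U z ->
    `|U x - z| ^+ 2 <= `|x - z| ^+ 2 - rho * `|U x - x| ^+ 2.

Definition weakly_regular (R : realType) (H : hilbertType R) (U : H -> H)
    : Prop :=
  forall (x : nat -> H) (n : nat -> nat) (l : H),
    increasing_seq n -> weakly_cvg (x \o n) l ->
    (fun k => U (x k) - x k) @ \oo --> (0 : H) -> Fix U l.

Definition boundedly_regular (R : realType) (H : hilbertType R) (U : H -> H)
    : Prop :=
  forall x : nat -> H, bounded_fun x ->
    (fun k => `|U (x k) - x k|) @ \oo --> (0 : R) ->
    (fun k => dist (x k) (Fix U)) @ \oo --> (0 : R).

Definition boundedly_linearly_regular (R : realType) (H : hilbertType R)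
    (U : H -> H) : Prop :=
  forall B : set H, bounded_set B ->
    exists2 delta : R, 0 < delta &
      forall x, B x -> delta * dist x (Fix U) <= `|U x - x|.

(* A family of sets is given as a list. *)
Definition family_inter (T : Type) (Cs : seq (set T)) : set T :=
  \big[setI/setT]_(C <- Cs) C.

(* Distances are nonnegative, so starting the maximum at 0 is harmless. *)
Definition max_dist (R : realType) (H : hilbertType R) (x : H)
    (Cs : seq (set H)) : R :=
  \big[Num.max/0]_(C <- Cs) dist x C.

(* The next two notions are meant for closed convex sets with a common point. *)
Definition family_boundedly_regular (R : realType) (H : hilbertType R)
    (Cs : seq (set H)) : Prop :=
  forall x : nat -> H, bounded_fun x ->
    (fun k => max_dist (x k) Cs) @ \oo --> (0 : R) ->
    (fun k => dist (x k) (family_inter Cs)) @ \oo --> (0 : R).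

Definition family_boundedly_linearly_regular (R : realType)
    (H : hilbertType R) (Cs : seq (set H)) : Prop :=
  forall B : set H, bounded_set B ->
    exists2 kappa : R, 0 < kappa &
      forall x, B x -> dist x (family_inter Cs) <= kappa * max_dist x Cs.

Definition tau (R : realType) (H1 H2 : hilbertType R) (A : {linear H1 -> H2})
    (T : H2 -> H2) (x : H1) : R :=
  if A x \in Fix T then 1
  else (opnorm A * `|T (A x) - A x| / `|adjoint A (T (A x) - A x)|) ^+ 2.

Definition extrapolation (R : realType) (H1 H2 : hilbertType R)
    (A : {linear H1 -> H2}) (T : H2 -> H2) (sigma : H1 -> R) : Prop :=
  forall x, 1 <= sigma x <= tau A T x.

(* Main.v *)
Require Import Defs.
From HB Require Import structures.
From mathcomp Require Import all_boot all_order all_algebra.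
From mathcomp Require Import all_classical all_reals all_analysis.
From mathcomp Require Import ring lra.

(** No step of the method moves the iterate away from any solution, and the
    squared distances to all solutions drop by a common amount.
    Write [s] for the full step length, [y = T (A x) - A x] for the residual of
    [T], [v = x + s *: adjoint A y] for the intermediate point and [x'] for
    [S v]. For a solution [z], strong quasi-nonexpansiveness of [T] says that
    [2 * inner (A x - A z) y <= - (1 + rhoT) * `|y| ^+ 2], and the bound
    [sigma <= tau] says that [`|v - x| ^+ 2 <= s * `|y| ^+ 2]. Expanding the
    square and applying strong quasi-nonexpansiveness of [S] gives
    [`|x' - z| ^+ 2 <= `|x - z| ^+ 2 - decrease] with
    [decrease = rhoS * `|S v - v| ^+ 2 + rhoT * (s * `|y| ^+ 2)]
    ([landweber_step_bounds], [sqr_dist_decrease]). So the sequence is Fejer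
    monotone, and its decreases tend to zero together with the residuals
    [v - x], [S v - v] and [y].

    For weak convergence, weak regularity puts every weak cluster point in [F],
    and Opial's argument ([fejer_weak_cvg]) shows that there is exactly one. The
    existence of cluster points is the weak sequential compactness of balls
    ([bounded_weakly_cvg_subseq]).

    For the other two modes, the inequality above does not depend on [z], so it
    passes to the infimum and holds for the distance to [F]. A Fejer monotone
    sequence with [dist (x k) F] tending to zero converges, with
    [`|x k - xoo| <= 2 * dist (x k) F] ([fejer_strong_cvg]). The regularity of
    [S], [T] and of the two families bounds the distance to [F] by the residuals.
    The passage from the distance between [A x] and [range A `&` Fix T] back to
    the distance between [x] and the preimage of [Fix T] uses that a bounded
    operator with closed range admits preimages of controlled norm
    ([closed_range_bounded_preimage]), which comes from the uniform boundedness
    principle. Under linear regularity the squared distance is at most a multiple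
    of the decrease, which makes the distance contract geometrically.

    The adjoint exists by the Riesz representation theorem, which rests on
    orthogonal projection on closed subspaces ([orthogonal_decomposition]). *)

Set Implicit Arguments.
Unset Strict Implicit.
Unset Printing Implicit Defensive.

Import Order.TTheory GRing.Theory Num.Theory.
Import numFieldNormedType.Exports.

Local Open Scope classical_set_scope.
Local Open Scope ring_scope.

(** * Inner products *)

Section InnerProduct.
Context {R : realType} {H : hilbertType R}.
Implicit Types (a : R) (x y z : H).

Lemma innerDr x y z : inner x (y + z) = inner x y + inner x z.
Proof. by rewrite innerC innerDl !(innerC _ x). Qed.

Lemma innerZr a x y : inner x (a *: y) = a * inner x y.
Proof. by rewrite innerC innerZl innerC. Qed.

Lemma inner0l x : inner 0 x = 0.
Proof. by rewrite -[X in inner X _](scale0r (0 : H)) innerZl mul0r. Qed.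

Lemma inner0r x : inner x 0 = 0.
Proof. by rewrite innerC inner0l. Qed.

Lemma innerNl x y : inner (- x) y = - inner x y.
Proof. by rewrite -scaleN1r innerZl mulN1r. Qed.

Lemma innerNr x y : inner x (- y) = - inner x y.
Proof. by rewrite innerC innerNl innerC. Qed.

Lemma innerBl x y z : inner (x - y) z = inner x z - inner y z.
Proof. by rewrite innerDl innerNl. Qed.

Lemma innerBr x y z : inner x (y - z) = inner x y - inner x z.
Proof. by rewrite innerDr innerNr. Qed.

Lemma sqr_normD x y : `|x + y| ^+ 2 = `|x| ^+ 2 + 2 * inner x y + `|y| ^+ 2.
Proof. by rewrite -!inner_norm innerDl !innerDr (innerC y x); ring. Qed.

Lemma sqr_normB x y : `|x - y| ^+ 2 = `|x| ^+ 2 - 2 * inner x y + `|y| ^+ 2.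
Proof. by rewrite sqr_normD innerNr normrN mulrN. Qed.

(** The square of the norm of [`|x| *: y - `|y| *: x] is nonnegative. *)
Lemma inner_le_norm x y : inner x y <= `|x| * `|y|.
Proof.
have [->|x0] := eqVneq x 0; first by rewrite inner0l normr0 mul0r.
have [->|y0] := eqVneq y 0; first by rewrite inner0r normr0 mulr0.
have : 0 <= `| `|x| *: y - `|y| *: x| ^+ 2 by exact: exprn_ge0.
rewrite sqr_normB !normrZ !normr_id innerZl innerZr (innerC y).
have -> : (`|x| * `|y|) ^+ 2 - 2 * (`|x| * (`|y| * inner x y))
    + (`|y| * `|x|) ^+ 2 = 2 * (`|x| * `|y|) * (`|x| * `|y| - inner x y) by ring.
by rewrite pmulr_rge0 ?subr_ge0 // !mulr_gt0 // normr_gt0.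
Qed.

Lemma cauchy_schwarz x y : `|inner x y| <= `|x| * `|y|.
Proof.
rewrite ler_norml inner_le_norm andbT lerNl -innerNl -[`|x|]normrN.
exact: inner_le_norm.
Qed.

Lemma norm_cvg_inner (I : Type) (G : set_system I) {FG : Filter G}
    (f : I -> H) (l y : H) :
  f @ G --> l -> (fun i => inner (f i) y) @ G --> inner l y.
Proof.
move=> fl; apply/cvgrPdist_le => e e0.
have y1 : 0 < `|y| + 1 by rewrite ltr_pwDr.
move/cvgrPdist_le : fl => /(_ (e / (`|y| + 1))) fl.
have {}fl := fl (divr_gt0 e0 y1).
near=> i; rewrite -innerBl (le_trans (cauchy_schwarz _ _)) //.
have : `|l - f i| <= e / (`|y| + 1) by near: i.
rewrite ler_pdivlMr //; apply: le_trans.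
by rewrite ler_wpM2l // lerDl.
Unshelve. all: by end_near. Qed.

Lemma cvg_weakly_cvg (x : nat -> H) (l : H) : x @ \oo --> l -> weakly_cvg x l.
Proof. by move=> xl y; apply: norm_cvg_inner. Qed.

Lemma eq_inner x y : (forall z, inner x z = inner y z) -> x = y.
Proof.
move=> xy; apply/eqP; rewrite -subr_eq0 -normr_eq0 -sqrf_eq0 -inner_norm.
by rewrite innerBl xy subrr.
Qed.

End InnerProduct.

(** * Orthogonal projection and the Riesz representation *)

Lemma cauchy_rate_cvg {R : realType} {H : completeNormedModType R}
    (u : nat -> H) (r : nat -> R) :
  (forall m n, (m <= n)%N -> `|u m - u n| <= r m) -> r @ \oo --> 0 ->
  exists l : H, u @ \oo --> l.
Proof.
move=> ur r0; suff : cvgn u by move/cvg_ex => [l ul]; exists l.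
apply/cauchy_cvgP/cauchy_exP => e e0.
have [N _ rN] := (cvgr0Pnorm_lt r).1 r0 e e0.
exists (u N), N => // n /= Nn.
rewrite -ball_normE /=; apply: le_lt_trans (ur _ _ Nn) _.
by apply: le_lt_trans (ler_norm _) _; apply: rN => /=.
Qed.

(** The parallelogram law makes a minimizing sequence for the distance to [M]
    Cauchy; its limit is the foot of the perpendicular. *)
Lemma orthogonal_decomposition {R : realType} {H : hilbertType R} (M : set H) :
  closed M -> M 0 -> (forall (a : R) u v, M u -> M v -> M (a *: u + v)) ->
  forall x, exists m p, [/\ x = m + p, M m & forall u, M u -> inner u p = 0].
Proof.
move=> Mcl M0 Mlin x.
pose D := [set `|x - c| | c in M].
have D0 : D !=set0 by exists `|x - 0|, 0.
have Dlb : has_lbound D by exists 0 => _ [c _ <-].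
have Dinf : has_inf D by [].
pose d := inf D.
have d_le c : M c -> d <= `|x - c| by move=> Mc; apply: ge_inf => //; exists c.
have d_ge0 : 0 <= d by apply: lb_le_inf => // _ [c _ <-].
have appr n : exists c, M c /\ `|x - c| < d + n.+1%:R^-1.
  have n0 : 0 < (n.+1%:R^-1 : R) by [].
  by have [_ [c Mc <-] xc] := inf_adherent n0 Dinf; exists c.
have [u uP] := choice appr.
have scaleM (a : R) v : M v -> M (a *: v).
  by move=> Mv; rewrite -[_ *: _]addr0; apply: Mlin.
have Mu n : M (u n) by case: (uP n).
have inv_le m n : (m <= n)%N -> (n.+1%:R^-1 : R) <= m.+1%:R^-1.
  by move=> mn; rewrite lef_pV2 ?posrE // ler_nat ltnS.
have cauchy_u m n : (m <= n)%N ->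
    `|u m - u n| <= Num.sqrt ((8 * d + 4) * m.+1%:R^-1).
  move=> mn; set e : R := m.+1%:R^-1.
  have e0 : 0 < e by rewrite invr_gt0 ltr0n.
  have e1 : e <= 1 by rewrite invf_le1 // ler1n.
  have hm : `|x - u m| ^+ 2 <= (d + e) ^+ 2.
    by rewrite ler_sqr ?nnegrE // ?addr_ge0 // ?(ltW e0) // ltW // (uP m).2.
  have hn : `|x - u n| ^+ 2 <= (d + e) ^+ 2.
    rewrite ler_sqr ?nnegrE // ?addr_ge0 // ?(ltW e0) //.
    by apply: le_trans (ltW (uP n).2) _; rewrite lerD2l inv_le.
  have mid : 4 * d ^+ 2 <= `|(x - u m) + (x - u n)| ^+ 2.
    have := d_le (2^-1 *: u m + 2^-1 *: u n) (Mlin _ _ _ (Mu m) (scaleM _ _ (Mu n))).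
    rewrite -(ler_sqr) ?nnegrE //.
    have -> : (x - u m) + (x - u n) = (2 : R) *: (x - (2^-1 *: u m + 2^-1 *: u n)).
      rewrite scalerBr scalerDr !scalerA divff ?pnatr_eq0 // !scale1r.
      by rewrite scaler_nat mulr2n opprD addrACA.
    by rewrite normrZ exprMn normr_nat (_ : (2%:R : R) ^+ 2 = 4) ?ler_pM2l //; ring.
  have -> : u m - u n = (x - u n) - (x - u m).
    by rewrite opprB [RHS]addrC addrA subrK.
  (* the parallelogram law bounds the square of the left-hand side by
     [4 (d + e)^2 - 4 d^2 = 8 d e + 4 e^2], and [e <= 1] *)
  rewrite -[X in X <= _]normr_id -sqrtr_sqr ler_wsqrtr //.
  have pl : `|(x - u n) - (x - u m)| ^+ 2 + `|(x - u m) + (x - u n)| ^+ 2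
      = 2 * `|x - u m| ^+ 2 + 2 * `|x - u n| ^+ 2.
    by rewrite sqr_normB (sqr_normD (x - u m)) (innerC (x - u n)); ring.
  nra.
have [l ul] : exists l : H, u @ \oo --> l.
  apply: cauchy_rate_cvg cauchy_u _.
  rewrite -sqrtr0; apply: continuous_cvg; first exact: sqrt_continuous.
  rewrite -(mulr0 (8 * d + 4)); apply: cvgMr; exact: cvg_harmonic.
have Ml : M l by apply: (closed_cvg M) ul => //; apply: nearW.
have xl : `|x - l| <= d.
  have cv : (fun n => `|x - u n|) @ \oo --> `|x - l|.
    by apply: cvg_norm; apply: cvgB => //; exact: cvg_cst.
  have cd : (fun n => d + n.+1%:R^-1) @ \oo --> d.
    rewrite -[X in _ --> X]addr0; apply: cvgD; first exact: cvg_cst.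
    exact: cvg_harmonic.
  by apply: ler_cvg_to cv cd _; apply: nearW => n; rewrite ltW // (uP n).2.
exists l, (x - l); split=> [||v Mv]; [by rewrite addrC subrK|by []|].
have [->|v0] := eqVneq v 0; first by rewrite inner0l.
have nv0 : 0 < `|v| ^+ 2 by rewrite exprn_gt0 // normr_gt0.
(* compare with the minimizer of [t => |x - l - t v|] *)
pose t := inner v (x - l) / `|v| ^+ 2.
have := le_trans xl (d_le (t *: v + l) (Mlin _ _ _ Mv Ml)).
rewrite -ler_sqr ?nnegrE // (_ : x - (t *: v + l) = (x - l) - t *: v); last first.
  by rewrite opprD addrCA addrC.
rewrite (sqr_normB (x - l)) innerZr normrZ exprMn real_normK ?num_real //.
rewrite (innerC (x - l)).
have -> : 2 * (t * inner v (x - l)) = 2 * t ^+ 2 * `|v| ^+ 2.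
  by rewrite /t; field; rewrite normr_eq0.
move=> h; have t0 : t ^+ 2 * `|v| ^+ 2 <= 0 by lra.
have : t == 0.
  by rewrite -sqrf_eq0 eq_le sqr_ge0 andbT -(pmulr_lle0 _ nv0).
by rewrite /t mulf_eq0 invr_eq0 (gt_eqF nv0) orbF => /eqP.
Qed.

(** The vector is a multiple of any [p] orthogonal to the kernel of [f], because
    [x - (f x / f p) *: p] lies in this kernel. *)
Lemma riesz {R : realType} {H : hilbertType R} (f : H -> R) (c : R) :
  (forall (a : R) x y, f (a *: x + y) = a * f x + f y) ->
  (forall x, `|f x| <= c * `|x|) ->
  exists z, forall x, f x = inner x z.
Proof.
move=> flin fc.
have f0 : f 0 = 0.
  by have := flin (-1) 0 0; rewrite scaler0 addr0 => ->; rewrite mulN1r addNr.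
have fZ (a : R) x : f (a *: x) = a * f x by rewrite -[a *: x]addr0 flin f0 addr0.
have fcont : continuous f.
  move=> x; apply/cvgrPdist_le => e e0; near=> y.
  rewrite (_ : f x - f y = f (x - y)); last first.
    by rewrite [x - y]addrC -[- y]scaleN1r flin mulN1r addrC.
  apply: le_trans (fc _) _.
  have c1 : 0 < `|c| + 1 by rewrite ltr_pwDr.
  have : `|x - y| <= e / (`|c| + 1).
    by near: y; apply: cvgr_dist_le => //; rewrite divr_gt0.
  rewrite ler_pdivlMr // mulrC; apply: le_trans.
  by rewrite ler_wpM2r // (le_trans (ler_norm c)) // lerDl.
have kcl : closed [set x | f x = 0].
  apply: (@preimage_closed _ _ f [set 0]); last exact: closed_eq.
  by move=> x _; exact: fcont.
have [all0|] := pselect (forall x, f x = 0).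
  by exists 0 => x; rewrite inner0r.
move/existsNP => [v /eqP fv].
have [m [p [vE fm mp]]] : exists m p,
    [/\ v = m + p, f m = 0 & forall u, f u = 0 -> inner u p = 0].
  apply: (orthogonal_decomposition kcl) => //= a u w fu fw.
  by rewrite flin fu fw mulr0 addr0.
have fp : f p = f v by rewrite vE -[m]scale1r flin fm mulr0 add0r.
have p0 : p != 0 by apply: contraNneq fv => p0; rewrite -fp p0 f0.
exists ((f p / `|p| ^+ 2) *: p) => x.
have : inner (x - (f x / f p) *: p) p = 0.
  by apply: mp; rewrite addrC -scaleNr flin mulNr divfK ?fp // addNr.
rewrite innerBl innerZl inner_norm innerZr => /eqP.
rewrite subr_eq0 => /eqP ->.
by field; rewrite fp fv normr_eq0 p0.
Unshelve. all: by end_near. Qed.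

(** * Bounded operators, adjoints and closed ranges *)

Lemma closure_linear {R : realType} {H : normedModType R} (M : set H) :
  (forall (a : R) u v, M u -> M v -> M (a *: u + v)) ->
  forall (a : R) u v, closure M u -> closure M v -> closure M (a *: u + v).
Proof.
move=> Mlin a u v uM vM B.
have : (fun z : H * H => a *: z.1 + z.2) @ (nbhs u, nbhs v) --> a *: u + v.
  by apply: cvgD; [apply: cvgZr; exact: cvg_fst|exact: cvg_snd].
move=> /[apply] -[[U V] /= [nU nV] UVB].
have [u' [Mu' Uu']] := uM U nU; have [v' [Mv' Vv']] := vM V nV.
by exists (a *: u' + v'); split; [exact: Mlin|exact: (UVB (u', v'))].
Qed.

Section BoundedOperator.
Context {R : realType} {H1 H2 : hilbertType R} (A : {linear H1 -> H2}).
Hypothesis A_bounded : bounded_near A (nbhs (0 : H1)).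

Lemma le_opnorm x : `|A x| <= opnorm A * `|x|.
Proof.
have [->|x0] := eqVneq x 0; first by rewrite linear0 !normr0 mulr0.
have nx0 : 0 < `|x| by rewrite normr_gt0.
have [r [r0 Ar]] : exists r : R, 0 < r /\ forall u, `|A u| <= r * `|u|.
  have /linear_boundedP := A_bounded.
  move=> /(pinfty_ex_gt0 (A := fun r => forall u, `|A u| <= r * `|u|)) [r].
  by exists r.
rewrite -ler_pdivrMr // -[`|x|]normr_id -normfV mulrC -normrZ -linearZ /=.
apply: ub_le_sup; last first.
  by exists (`|x|^-1 *: x) => //=; rewrite normrZ normfV normr_id mulVf ?gt_eqF.
exists r => _ [u /= u1 <-]; apply: le_trans (Ar u) _.
by rewrite ler_piMr // ltW.
Qed.

Lemma opnorm_ge0 : 0 <= opnorm A.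
Proof.
have [[x x0]|] := pselect (exists x, A x != 0).
  rewrite leNgt; apply/negP => lt0; have := le_opnorm x; apply/negP.
  by rewrite -ltNge (le_lt_trans _ (y := 0)) ?normr_gt0 // nmulr_rle0.
move=> A0; rewrite /opnorm (_ : [set _ | _ in _] = [set 0]) ?sup1 //.
have {}A0 x : A x = 0 by apply: contrapT => /eqP Ax; apply: A0; exists x.
rewrite eqEsubset; split => [_ [x _ <-]|_ ->]; first by rewrite A0 normr0.
by exists 0; rewrite /= ?A0 normr0.
Qed.

Lemma opnorm_gt0 : (exists x, A x != 0) -> 0 < opnorm A.
Proof.
move=> [x Ax]; rewrite lt_neqAle opnorm_ge0 andbT eq_sym; apply: contra_neq Ax => o0.
by apply/eqP; rewrite -normr_le0; have := le_opnorm x; rewrite o0 mul0r.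
Qed.

Lemma bounded_linear_continuous x : {for x, continuous A}.
Proof. by have /linear_bounded_continuous := A_bounded; apply. Qed.

Lemma adjointP x y : inner (A x) y = inner x (adjoint A y).
Proof.
have ex : exists z, forall x, inner (A x) y = inner x z.
  apply: (@riesz _ _ _ (opnorm A * `|y|)) => [a u v|u].
    by rewrite linearP innerDl innerZl.
  apply: le_trans (cauchy_schwarz _ _) _.
  by rewrite mulrAC ler_wpM2r // le_opnorm.
exact: (xgetPex 0 ex).
Qed.

Lemma adjointE y z : (forall x, inner (A x) y = inner x z) -> adjoint A y = z.
Proof. by move=> yz; apply: eq_inner => x; rewrite innerC -adjointP yz innerC. Qed.

Lemma adjoint_linear (a : R) y z :
  adjoint A (a *: y + z) = a *: adjoint A y + adjoint A z.
Proof. by apply: adjointE => x; rewrite !innerDr !innerZr !adjointP. Qed.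

Lemma adjoint0 : adjoint A 0 = 0.
Proof. by apply: adjointE => x; rewrite !inner0r. Qed.

Lemma adjointZ (a : R) y : adjoint A (a *: y) = a *: adjoint A y.
Proof. by rewrite -[a *: y]addr0 adjoint_linear adjoint0 addr0. Qed.

Lemma le_norm_adjoint y : `|adjoint A y| <= opnorm A * `|y|.
Proof.
have [->|y0] := eqVneq (adjoint A y) 0; first by rewrite normr0 mulr_ge0 ?opnorm_ge0.
rewrite -(@ler_pM2r _ `|adjoint A y|) ?normr_gt0 // -expr2 -inner_norm -adjointP.
apply: le_trans (inner_le_norm _ _) _.
by rewrite mulrAC ler_wpM2r // le_opnorm.
Qed.

(** The functionals [inner w], for [w] in the range with [`|adjoint A w| <= 1],
    are bounded at each point: at [y] they only see the orthogonal projection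
    [A u] of [y] on the range, where [inner w (A u) = inner (adjoint A w) u].
    The uniform boundedness principle then bounds the norms of these [w]. *)
Lemma adjoint_bounded_below : closed (range A) ->
  exists2 C : R, 0 < C & forall x, `|A x| <= C * `|adjoint A (A x)|.
Proof.
move=> Acl.
pose Fam : set (H2 -> R^o) :=
  [set f | exists x, `|adjoint A (A x)| <= 1 /\ f = inner (A x)].
have Fam_lin f : Fam f -> bounded_fun_norm f /\ linear f.
  move=> [x [_ ->]]; split=> [r|a u v]; last by rewrite innerDr innerZr.
  exists (`|A x| * r) => u ur; apply: le_trans (cauchy_schwarz _ _) _.
  by rewrite ler_wpM2l.
have Fam_bnd : pointwise_bounded Fam.
  move=> y.
  have [||m [p [yE [u _ mE] mp]]] := orthogonal_decomposition Acl _ _ y.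
  - by exists 0; rewrite ?linear0.
  - by move=> a _ _ [u _ <-] [v _ <-]; exists (a *: u + v); rewrite ?linearP.
  exists `|u| => f [x [x1 ->]].
  rewrite yE innerDr mp ?addr0; last by exists x.
  rewrite -mE innerC adjointP; apply: le_trans (cauchy_schwarz _ _) _.
  by rewrite ler_piMr.
have [M Mb] := Banach_Steinhauss Fam_lin Fam_bnd 1.
have M1 : 0 < `|M| + 1 by rewrite ltr_pwDr.
exists (`|M| + 1) => // x.
have [Ax0|Ax0] := eqVneq (A x) 0; first by rewrite Ax0 normr0 mulr_ge0 // ltW.
have nAx : 0 < `|A x| by rewrite normr_gt0.
have nAAx : 0 < `|adjoint A (A x)|.
  rewrite normr_gt0; apply: contra_neq Ax0 => AA0.
  by apply/eqP; rewrite -normr_eq0 -sqrf_eq0 -inner_norm adjointP AA0 inner0r.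
set b := `|adjoint A (A x)| in nAAx *.
have : `|inner (A (b^-1 *: x)) (`|A x|^-1 *: A x)| <= M.
  apply: Mb.
    exists (b^-1 *: x); split => //.
    by rewrite linearZ adjointZ normrZ normfV (gtr0_norm nAAx) mulVf ?gt_eqF.
  by rewrite normrZ normfV normr_id mulVf ?gt_eqF.
rewrite linearZ /= innerZl innerZr inner_norm expr2 mulKf ?gt_eqF //.
rewrite ger0_norm ?mulr_ge0 ?invr_ge0 ?(ltW nAAx) // ler_pdivrMl //.
rewrite mulrC => /le_trans.
apply; rewrite ler_wpM2r ?(ltW nAAx) //.
by rewrite (le_trans (ler_norm _)) // lerDl.
Qed.

(** The preimage is the projection of [x] on the closure of the range of the
    adjoint, which is orthogonal to the kernel of [A]. On the range of the
    adjoint itself, [m = adjoint A (A u)] gives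
    [`|m| ^+ 2 = inner (A u) (A m) <= C * `|m| * `|A m|]. *)
Lemma closed_range_bounded_preimage : closed (range A) ->
  exists2 C : R, 0 < C & forall x, exists u, A u = A x /\ `|u| <= C * `|A x|.
Proof.
move=> Acl; have [C C0 CA] := adjoint_bounded_below Acl; exists C => // x.
pose M := range (adjoint A).
have M0 : M 0 by exists 0 => //; exact: adjoint0.
have Mlin (a : R) u v : M u -> M v -> M (a *: u + v).
  by move=> [y _ <-] [z _ <-]; exists (a *: y + z) => //; exact: adjoint_linear.
have [m [p [xE mM mp]]] := orthogonal_decomposition (@closed_closure _ M)
  (@subset_closure _ M _ M0) (closure_linear Mlin) x.
have Ap : A p = 0.
  apply: eq_inner => y; rewrite inner0l adjointP innerC; apply: mp.
  by apply: subset_closure; exists y.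
exists m; split; first by rewrite xE linearD /= Ap addr0.
have -> : A x = A m by rewrite xE linearD /= Ap addr0.
suff : closure M `<=` [set m | `|m| - C * `|A m| <= 0].
  by move=> /(_ m mM) /=; rewrite subr_le0.
pose g (z : H1) : R := `|z| - C * `|A z|.
have gcl : closed (g @^-1` [set t | t <= 0]).
  apply: preimage_closed; last exact: closed_le.
  move=> z _; apply: cvgB; first exact: norm_continuous.
  by apply: cvgMr; apply: cvg_norm; exact: bounded_linear_continuous.
apply: (@subset_trans _ (closure (g @^-1` [set t | t <= 0]))); last first.
  by rewrite -((closure_id _).1 gcl).
apply: closure_subset.
move=> _ [y _ <-] /=; rewrite subr_le0.
have [||w [q [yE [u _ wE] wq]]] := orthogonal_decomposition Acl _ _ y.
- by exists 0; rewrite ?linear0.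
- by move=> a _ _ [u _ <-] [v _ <-]; exists (a *: u + v); rewrite ?linearP.
have -> : adjoint A y = adjoint A (A u).
  by apply: adjointE => z; rewrite yE innerDr (wq (A z)) ?addr0 ?wE ?adjointP.
set n := adjoint A (A u).
have [->|n0] := eqVneq n 0; first by rewrite normr0 mulr_ge0 // ltW.
rewrite -(@ler_pM2l _ `|n|) ?normr_gt0 // -expr2 -inner_norm {2}/n -adjointP innerC.
apply: le_trans (inner_le_norm _ _) _.
by rewrite mulrCA mulrA ler_wpM2r // CA.
Qed.

End BoundedOperator.

(** * Weak sequential compactness *)

(** A bounded real family converges along every ultrafilter: a cluster point of
    the image filter is a limit, since the ultrafilter decides each preimage. *)
Lemma ultrafilter_bounded_cvg {R : realType} {I : Type} (U : set_system I)
    (f : I -> R) (c : R) : UltraFilter U ->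
  (forall i, `|f i| <= c) -> exists l : R, f @ U --> l.
Proof.
move=> UU fc.
have [l [_ lf]] : `[- c, c] `&` cluster (f @ U) !=set0.
  apply: segment_compact; rewrite /fmap /=; apply: (@filterE _ U) => i /=.
  by rewrite in_itv /= -ler_norml.
exists l => V Vl; have [//|nV] := in_ultra_setVsetC (f @^-1` V) UU.
have [r [/= nVr Vr]] := lf (~` V) V nV Vl.
by have := nVr Vr.
Qed.

(** The limit [l] represents the functional [y |-> lim inner (x k) y] along a
    free ultrafilter. The extraction only controls [inner (x k - l) (x i)] for
    the countably many vectors [x i]; the vectors [y] tested correctly by the
    subsequence form a closed subspace containing the [x i], and a vector
    orthogonal to it is orthogonal to all [x i], hence also to [l]. *)
Lemma bounded_weakly_cvg_subseq {R : realType} {H : hilbertType R}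
    (x : nat -> H) (c : R) : (forall k, `|x k| <= c) ->
  exists n l, increasing_seq n /\ weakly_cvg (x \o n) l.
Proof.
move=> xc.
have c0 : 0 <= c by apply: le_trans (xc 0%N).
have [U [UU Uoo]] := ultraFilterLemma eventually_filter.
have lim_ex y : exists a : R, (fun k => inner (x k) y) @ U --> a.
  apply: (@ultrafilter_bounded_cvg _ _ _ _ (c * `|y|)) => k.
  by apply: le_trans (cauchy_schwarz _ _) _; rewrite ler_wpM2r.
have [f fP] := choice lim_ex.
have flin (a : R) y z : f (a *: y + z) = a * f y + f z.
  apply: (cvg_unique _ (fP _)) => //.
  rewrite (_ : (fun k => _) = fun k => a * inner (x k) y + inner (x k) z).
    by apply: cvgD => //; apply: cvgMr.
  by apply/funext => k; rewrite innerDr innerZr.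
have fbnd y : `|f y| <= c * `|y|.
  have nf : (fun k => `|inner (x k) y|) @ U --> `|f y| by exact: cvg_norm.
  apply: (@closed_cvg _ _ U _ _ [set t | t <= c * `|y|] _ _ _ nf).
    exact: closed_le.
  apply: nearW => k /=; apply: le_trans (cauchy_schwarz _ _) _.
  by rewrite ler_wpM2r.
have [l fl] := riesz flin fbnd.
have small (e : R) : 0 < e -> forall m,
    U [set k | forall i, (i < m)%N -> `|inner (x k - l) (x i)| < e].
  move=> e0; elim=> [|m IH]; first by apply: filterE.
  have /cvgrPdist_lt /(_ e e0) := fP (x m).
  move=> /(filterI IH); apply: filterS => k /= [IHk km] i.
  rewrite ltnS leq_eqVlt => /predU1P[->|/IHk//].
  by rewrite innerBl distrC (innerC l) -fl.
have next (jN : nat * nat) : exists k, (jN.2 < k)%N /\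
    forall i, (i < jN.1)%N -> `|inner (x k - l) (x i)| < jN.1.+1%:R^-1.
  have j0 : 0 < (jN.1.+1%:R^-1 : R) by rewrite invr_gt0.
  have UN : U [set k | (jN.2 < k)%N] by apply: Uoo; exists jN.2.+1.
  by have [k [? ?]] := filter_ex (filterI UN (small _ j0 jN.1)); exists k.
have [g gP] := choice next.
pose n := fix n j := g (j, if j is i.+1 then n i else 0%N).
have nS j : (n j < n j.+1)%N by case: (gP (j.+1, n j)).
have nP j i : (i < j)%N -> `|inner (x (n j) - l) (x i)| < j.+1%:R^-1.
  by case: j => // j; case: (gP (j.+1, n j)) => _; apply.
exists n, l; split; first by apply/increasing_seqP => j; rewrite ltEnat; exact: nS.
pose M := [set y | (fun j => inner (x (n j) - l) y) @ \oo --> (0 : R)].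
have Mx i : M (x i).
  apply/cvgr0Pnorm_le => e e0.
  have he : \forall j \near \oo, `|harmonic j : R| <= e.
    by apply: (cvgr0Pnorm_le _).1 e e0; exact: cvg_harmonic.
  near=> j; apply: (le_trans (ltW (nP j i _))).
    by near: j; exact: nbhs_infty_gt.
  by near: j; apply: filterS he => j /=; rewrite ger0_norm ?invr_ge0.
have M0 : M 0.
  rewrite /M /= (_ : (fun j => _) = cst 0); first exact: cvg_cst.
  by apply/funext => j; rewrite inner0r.
have Mlin (a : R) u v : M u -> M v -> M (a *: u + v).
  move=> Mu Mv; rewrite /M /= (_ : (fun j => _) =
      fun j => a * inner (x (n j) - l) u + inner (x (n j) - l) v); last first.
    by apply/funext => j; rewrite innerDr innerZr.
  rewrite -[X in _ --> X]addr0 -[X in _ --> X + _](mulr0 a).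
  by apply: cvgD => //; apply: cvgMr.
have Mcl : closed M.
  move=> y yM; apply/cvgr0Pnorm_le => e e0.
  have d0 : 0 < c + `|l| + 1 by rewrite ltr_pwDr // addr_ge0.
  have e'0 : 0 < e / 2 / (c + `|l| + 1) by rewrite !divr_gt0.
  have [y' [My']] := yM _ (nbhsx_ballx y _ e'0).
  rewrite -ball_normE /= => yy'.
  near=> j.
  have jy' : `|inner (x (n j) - l) y'| <= e / 2.
    by near: j; apply: (cvgr0Pnorm_le _).1 My' _ _; rewrite divr_gt0.
  rewrite -(subrK y' y) innerDr [e]splitr; apply: le_trans (ler_normD _ _) _.
  apply: lerD => //; apply: le_trans (cauchy_schwarz _ _) _.
  move: yy'; rewrite ltr_pdivlMr // => /ltW; apply: le_trans.
  rewrite mulrC ler_wpM2l //.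
  apply: le_trans (ler_normB _ _) _.
  by rewrite -addrA lerD // lerDl.
move=> y.
have [m [p [-> Mm mp]]] := orthogonal_decomposition Mcl M0 Mlin y.
have xp k : inner (x k) p = 0 by exact: mp.
have lp : inner l p = 0.
  rewrite innerC -fl; apply: (cvg_unique _ (fP p)) => //.
  rewrite (_ : (fun k => _) = cst 0); first exact: cvg_cst.
  by apply/funext => k; rewrite xp.
rewrite innerDr lp addr0 -[X in _ --> X]add0r.
rewrite (_ : (fun k => _) = fun k => inner (x (n k) - l) m + inner l m).
  by apply: cvgD => //; exact: cvg_cst.
by apply/funext => k /=; rewrite innerBl subrK innerDr xp addr0.
Unshelve. all: by end_near. Qed.

(** * Distance to a set *)

Section Distance.
Context {R : realType} {H : hilbertType R}.
Implicit Types (x y c : H) (C : set H).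

Lemma dist_has_lbound x C : has_lbound [set `|x - c| | c in C].
Proof. by exists 0 => _ [c _ <-]. Qed.

Lemma dist_le x c C : C c -> dist x C <= `|x - c|.
Proof. by move=> Cc; apply: ge_inf; [exact: dist_has_lbound|exists c]. Qed.

Lemma le_dist x C (r : R) : C !=set0 -> (forall c, C c -> r <= `|x - c|) ->
  r <= dist x C.
Proof.
move=> [c Cc] rx; apply: lb_le_inf => [|_ [d Cd <-]]; last exact: rx.
by exists `|x - c|, c.
Qed.

Lemma dist_ge0 x C : C !=set0 -> 0 <= dist x C.
Proof. by move=> C0; apply: le_dist. Qed.

Lemma dist_lt x C (r : R) : C !=set0 -> dist x C < r ->
  exists2 c, C c & `|x - c| < r.
Proof.
move=> [c Cc]; rewrite /dist => /inf_lt [|_ [d Cd <-] dr]; last by exists d.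
by exists `|x - c|, c.
Qed.

Lemma dist_le_shift x y C : C !=set0 -> dist x C <= `|x - y| + dist y C.
Proof.
move=> C0; rewrite -lerBlDl; apply: le_dist => // c Cc.
by rewrite lerBlDl (le_trans (dist_le x Cc)) // ler_distD.
Qed.

Lemma sqr_dist_le_sub x y C (s : R) : C !=set0 -> 0 <= s ->
  (forall c, C c -> `|y - c| ^+ 2 <= `|x - c| ^+ 2 - s) ->
  dist y C ^+ 2 <= dist x C ^+ 2 - s.
Proof.
move=> C0 s0 yx; rewrite lerBrDr.
have h : Num.sqrt (dist y C ^+ 2 + s) <= dist x C.
  apply: le_dist => // c Cc; rewrite -[leRHS]normr_id -sqrtr_sqr ler_wsqrtr //.
  rewrite -lerBrDr; apply: le_trans (yx c Cc).
  by rewrite ler_sqr ?nnegrE ?dist_ge0 // dist_le.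
rewrite -[leLHS]sqr_sqrtr ?addr_ge0 ?sqr_ge0 //.
by rewrite ler_sqr ?nnegrE ?sqrtr_ge0 // dist_ge0.
Qed.

Lemma dist_eq0_closed x C : closed C -> C !=set0 -> dist x C <= 0 -> C x.
Proof.
move=> Ccl C0 d0; apply: Ccl => V /nbhs_ballP [e /= e0 eV].
have [c Cc xc] := dist_lt C0 (le_lt_trans d0 e0).
by exists c; split => //; apply: eV; rewrite -ball_normE.
Qed.

End Distance.

(** * Fejer monotone sequences *)

Lemma increasing_seq_cvg_infty (m : nat -> nat) :
  increasing_seq m -> m @ \oo --> \oo.
Proof.
move=> m_incr; have mk k : (k <= m k)%N.
  elim: k => // k IH; apply: leq_ltn_trans IH _.
  by have /increasing_seqP/(_ k) := m_incr; rewrite ltEnat.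
move=> V [N _ NV]; exists N => // k /= Nk; apply: NV => /=.
exact: leq_trans (mk k).
Qed.

Definition fejer_monotone {R : realType} {H : hilbertType R} (F : set H)
    (x : nat -> H) :=
  forall k z, F z -> `|x k.+1 - z| <= `|x k - z|.

Section FejerMonotone.
Context {R : realType} {H : hilbertType R} (F : set H) (x : nat -> H).
Hypotheses (F0 : F !=set0) (xF : fejer_monotone F x).

Lemma fejer_le m n z : (m <= n)%N -> F z -> `|x n - z| <= `|x m - z|.
Proof.
move=> + Fz; elim: n => [|n IH]; first by rewrite leqn0 => /eqP ->.
by rewrite leq_eqVlt => /predU1P[->//|/IH]; apply: le_trans; exact: xF.
Qed.

Lemma fejer_bounded : exists c, forall k, `|x k| <= c.
Proof.
have [z Fz] := F0; exists (`|x 0%N - z| + `|z|) => k.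
rewrite -[x k](subrK z); apply: le_trans (ler_normD _ _) _.
by rewrite lerD2r fejer_le.
Qed.

Lemma fejer_cvg_norm z : F z -> exists a : R, (fun k => `|x k - z|) @ \oo --> a.
Proof.
move=> Fz; exists (lim ((fun k => `|x k - z|) @ \oo)); apply: nonincreasing_is_cvgn.
  by move=> m n mn; exact: fejer_le.
by exists 0 => _ [k _ <-].
Qed.

(** Every [z] in [F] is at least as close to [x n] as to [x m], so that
    [`|x m - x n| <= 2 * `|x m - z|]; take the infimum over [z]. *)
Lemma fejer_dist_bound m n : (m <= n)%N -> `|x m - x n| <= 2 * dist (x m) F.
Proof.
move=> mn; rewrite -ler_pdivrMl //; apply: le_dist => // z Fz.
rewrite ler_pdivrMl // mulr_natl mulr2n; apply: le_trans (ler_distD z _ _) _.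
by rewrite lerD2l distrC fejer_le.
Qed.

Lemma fejer_strong_cvg : closed F -> (fun k => dist (x k) F) @ \oo --> (0 : R) ->
  exists xoo, [/\ F xoo, x @ \oo --> xoo &
    forall k, `|x k - xoo| <= 2 * dist (x k) F].
Proof.
move=> Fcl d0.
have d20 : (fun k => 2 * dist (x k) F) @ \oo --> (0 : R).
  by rewrite -(mulr0 (2 : R)); apply: cvgMr.
have [l xl] := cauchy_rate_cvg fejer_dist_bound d20.
have xkl k : `|x k - l| <= 2 * dist (x k) F.
  have cv : (fun n => `|x k - x n|) @ \oo --> `|x k - l|.
    by apply: cvg_norm; apply: cvgB => //; exact: cvg_cst.
  apply: ler_cvg_to cv (cvg_cst (2 * dist (x k) F)) _.
  by near=> n; apply: fejer_dist_bound; near: n; exact: nbhs_infty_ge.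
exists l; split => //; apply: dist_eq0_closed => //.
have d30 : (fun k => 3 * dist (x k) F) @ \oo --> (0 : R).
  by rewrite -(mulr0 (3 : R)); apply: cvgMr.
apply: ler_cvg_to (cvg_cst (dist l F)) d30 _; apply: nearW => k.
apply: le_trans (dist_le_shift l (x k) F0) _; rewrite distrC.
by have := xkl k; lra.
Unshelve. all: by end_near. Qed.

(** Opial's argument: [|x k - z| ^+ 2 - |x k - z'| ^+ 2] is affine in [x k] with
    linear part [2 * inner (x k) (z' - z)] and converges, so that all the weak
    cluster points in [F] have the same inner product with their differences. *)
Lemma fejer_weak_cvg :
  (forall n l, increasing_seq n -> weakly_cvg (x \o n) l -> F l) ->
  exists2 xoo, F xoo & weakly_cvg x xoo.
Proof.
move=> clF; have [c xc] := fejer_bounded.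
have [n [l [n_incr xl]]] := bounded_weakly_cvg_subseq xc.
have Fl := clF _ _ n_incr xl; exists l => //.
have uniq_cluster m l' : increasing_seq m -> weakly_cvg (x \o m) l' -> l' = l.
  move=> m_incr xl'; have Fl' := clF _ _ m_incr xl'.
  have [a xa] := fejer_cvg_norm Fl; have [a' xa'] := fejer_cvg_norm Fl'.
  have [b xb] : exists b : R, (fun k => inner (x k) (l - l')) @ \oo --> b.
    exists (2^-1 * (a' ^+ 2 - a ^+ 2 + `|l| ^+ 2 - `|l'| ^+ 2)).
    rewrite (_ : (fun k => _) = fun k => 2^-1 *
        (`|x k - l'| ^+ 2 - `|x k - l| ^+ 2 + `|l| ^+ 2 - `|l'| ^+ 2)).
      apply: cvgMr; apply: cvgB; last exact: cvg_cst.
      apply: cvgD; last exact: cvg_cst.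
      by apply: cvgB; rewrite expr2; apply: cvgM.
    by apply/funext => k; rewrite !sqr_normB innerBr; field.
  have b1 : inner l (l - l') = b.
    apply: cvg_unique (xl (l - l')) _ => //.
    exact: (cvg_comp _ _ (increasing_seq_cvg_infty n_incr) xb).
  have b2 : inner l' (l - l') = b.
    apply: cvg_unique (xl' (l - l')) _ => //.
    exact: (cvg_comp _ _ (increasing_seq_cvg_infty m_incr) xb).
  apply/esym/eqP; rewrite -subr_eq0 -normr_eq0 -sqrf_eq0 -inner_norm.
  by rewrite innerBl b1 b2 subrr.
(* a subsequence on which the inner product with [y] stays away from its
   expected limit would still have a weak cluster point *)
move=> y; apply/cvgrPdist_lt => e e0; apply: contrapT => nev.
have far N : exists k, (N < k)%N /\ e <= `|inner l y - inner (x k) y|.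
  apply: contrapT => nk; apply: nev; exists N.+1 => // k /= Nk.
  by rewrite ltNge; apply/negP => ek; apply: nk; exists k.
have [g gP] := choice far.
pose m := fix m j := g (if j is i.+1 then m i else 0%N).
have mS j : (m j < m j.+1)%N by case: (gP (m j)).
have mP j : e <= `|inner l y - inner (x (m j)) y|.
  by case: j => [|j]; [case: (gP 0%N)|case: (gP (m j))].
have m_incr : increasing_seq m.
  by apply/increasing_seqP => j; rewrite ltEnat; exact: mS.
have [n' [l' [n'_incr xl']]] :=
  @bounded_weakly_cvg_subseq _ _ (x \o m) c (fun k => xc (m k)).
have mn'_incr : increasing_seq (m \o n').
  by move=> i j /=; rewrite m_incr -leEnat n'_incr.
have l'l : l' = l by apply: uniq_cluster mn'_incr xl'.
have /cvgrPdist_lt/(_ e e0) := xl' y; rewrite l'l => /(@filter_ex _ _ _)[k /=].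
by rewrite ltNge mP.
Qed.

End FejerMonotone.

(** * Strongly quasi-nonexpansive operators *)

Section SQNEOperators.
Context {R : realType} {H : hilbertType R} (rho : R) (U : H -> H).
Hypotheses (rho_gt0 : 0 < rho) (U_SQNE : SQNE rho U).

Lemma closed_Fix_SQNE : closed (Fix U).
Proof.
(* a fixed point within half of [`|U y - y|] of [y] would be further from [U y] *)
move=> y yF; apply: contrapT => /eqP; rewrite -subr_eq0 -normr_gt0 => Uy.
have [z [Fz]] := yF _ (nbhsx_ballx y _ (divr_gt0 Uy (ltr0n R 2))).
rewrite -ball_normE /= ltr_pdivlMr // mulr_natr mulr2n ltNge => /negP; apply.
apply: le_trans (ler_distD z _ _) _; rewrite [`|z - y|]distrC lerD2r.
rewrite -ler_sqr ?nnegrE //; apply: le_trans (U_SQNE.2 y z Fz) _.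
by rewrite gerBl mulr_ge0 ?(ltW rho_gt0) ?sqr_ge0.
Qed.

(** Expand [`|U x - z| ^+ 2 = `|(x - z) + (U x - x)| ^+ 2]. *)
Lemma SQNE_inner x z : Fix U z ->
  2 * inner (x - z) (U x - x) <= - ((1 + rho) * `|U x - x| ^+ 2).
Proof.
move=> /(U_SQNE.2 x); have -> : U x - z = (x - z) + (U x - x).
  by rewrite [RHS]addrC addrA subrK.
by rewrite (sqr_normD (x - z)); lra.
Qed.

End SQNEOperators.

(** * The extrapolated Landweber step *)

Definition landweber_step {R : realType} {H1 H2 : hilbertType R}
    (A : {linear H1 -> H2}) (T : H2 -> H2) (s : R) (x : H1) : H1 :=
  x + s *: adjoint A (T (A x) - A x).

Section Landweber.
Context {R : realType} {H1 H2 : hilbertType R}.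
Variables (A : {linear H1 -> H2}) (T : H2 -> H2) (rho : R).
Hypothesis A_bounded : bounded_near A (nbhs (0 : H1)).
Hypothesis A_nonzero : exists v, A v != 0.
Hypotheses (rho_gt0 : 0 < rho) (T_SQNE : SQNE rho T).

(** If [adjoint A] kills [T (A x) - A x], then so does the inner product with
    [A x - A z] when [A z] is fixed, and [SQNE_inner] leaves no room for a
    nonzero residual. *)
Lemma adjoint_residual_eq0 x z : Fix T (A z) ->
  adjoint A (T (A x) - A x) = 0 -> Fix T (A x).
Proof.
move=> Fz g0; have := SQNE_inner T_SQNE (A x) Fz.
rewrite -linearB adjointP // g0 inner0r mulr0 oppr_ge0.
rewrite pmulr_rle0 ?addr_gt0 // => y0; apply/eqP; rewrite -subr_eq0 -normr_eq0.
by rewrite -sqrf_eq0 eq_le y0 sqr_ge0.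
Qed.

Lemma tau_ge1 z x : Fix T (A z) -> 1 <= tau A T x.
Proof.
move=> Fz; rewrite /tau; case: ifPn => // /negP Tx.
have g0 : 0 < `|adjoint A (T (A x) - A x)|.
  rewrite normr_gt0; apply/negP => /eqP g0; apply: Tx; apply/mem_set.
  exact: adjoint_residual_eq0 Fz g0.
rewrite expr_ge1 // ?divr_ge0 ?mulr_ge0 ?opnorm_ge0 // ler_pdivlMr // mul1r.
exact: le_norm_adjoint.
Qed.

Lemma le_tau_sqr_norm (sig : R) x : sig <= tau A T x ->
  sig * `|adjoint A (T (A x) - A x)| ^+ 2 <= opnorm A ^+ 2 * `|T (A x) - A x| ^+ 2.
Proof.
rewrite /tau; case: ifPn => [/set_mem/= -> _|_].
  by rewrite subrr adjoint0 // !normr0 expr0n !mulr0.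
have [->|g0] := eqVneq (adjoint A (T (A x) - A x)) 0.
  by rewrite normr0 expr0n mulr0 mulr_ge0 ?sqr_ge0.
by rewrite expr_div_n exprMn ler_pdivlMr // exprn_gt0 // normr_gt0.
Qed.

(** The bound [sig <= tau] is exactly what makes the quadratic term of the step,
    [`|v - x| ^+ 2], at most [s * `|y| ^+ 2]; the linear term is at most
    [- (1 + rho) * s * `|y| ^+ 2] by [SQNE_inner] and absorbs it. *)
Lemma landweber_step_bounds (lam sig : R) x : 0 <= lam <= 1 ->
  1 <= sig <= tau A T x ->
  let s := lam * (sig / opnorm A ^+ 2) in
  let y := T (A x) - A x in
  let v := landweber_step A T s x in
  `|v - x| ^+ 2 <= s * `|y| ^+ 2 /\
  forall z, Fix T (A z) ->
    `|v - z| ^+ 2 <= `|x - z| ^+ 2 - rho * (s * `|y| ^+ 2).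
Proof.
move=> /andP[lam0 lam1] /andP[sig1 sig_tau] s y v.
have op0 : 0 < opnorm A ^+ 2 by rewrite exprn_gt0 // opnorm_gt0.
have s0 : 0 <= s by rewrite mulr_ge0 // divr_ge0 ?(ltW op0) // (le_trans ler01).
have vx : `|v - x| ^+ 2 <= s * `|y| ^+ 2.
  rewrite /v /landweber_step addrC addKr normrZ exprMn real_normK ?num_real //.
  rewrite expr2 -mulrA ler_wpM2l // /s -mulrA.
  have h : sig / opnorm A ^+ 2 * `|adjoint A y| ^+ 2 <= `|y| ^+ 2.
    by rewrite mulrAC ler_pdivrMr // [leRHS]mulrC le_tau_sqr_norm.
  apply: le_trans (ler_piMl _ lam1) h.
  by rewrite mulr_ge0 ?sqr_ge0 // divr_ge0 ?(ltW op0) // (le_trans ler01).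
split=> // z Fz.
have h : 2 * (s * inner (x - z) (adjoint A y)) <= - (s * ((1 + rho) * `|y| ^+ 2)).
  rewrite -adjointP // linearB /= -mulrN mulrCA ler_wpM2l //.
  exact: SQNE_inner T_SQNE _ _ Fz.
rewrite (_ : v - z = (x - z) + (v - x)); last by rewrite [RHS]addrC addrA subrK.
rewrite (sqr_normD (x - z)).
rewrite (_ : inner _ (v - x) = s * inner (x - z) (adjoint A y)); last first.
  by rewrite -innerZr; congr inner; rewrite /v /landweber_step addrC addKr.
by lra.
Qed.

End Landweber.

(** * Regular operators and families along a bounded sequence *)

Lemma bounded_fun_le {R : realType} {V : normedModType R} {I : Type} (f : I -> V)
    (c : R) : (forall i, `|f i| <= c) -> bounded_fun f.
Proof.
move=> fc; exists c; split; first exact: num_real.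
by move=> M cM i _ /=; apply: le_trans (fc i) _; exact: ltW.
Qed.

Lemma bounded_set_range {R : realType} {V : normedModType R} {I : Type} (f : I -> V)
    (c : R) : (forall i, `|f i| <= c) -> bounded_set (range f).
Proof.
move=> fc; exists c; split; first exact: num_real.
by move=> M cM _ [i _ <-] /=; apply: le_trans (fc i) _; exact: ltW.
Qed.

Lemma family_inter2 (T : Type) (C D : set T) : family_inter [:: C; D] = C `&` D.
Proof. by rewrite /family_inter !big_cons big_nil setIT. Qed.

Lemma max_dist2_bounds {R : realType} {H : hilbertType R} (x : H) (C D : set H) :
  C !=set0 -> D !=set0 -> 0 <= max_dist x [:: C; D] <= dist x C + dist x D.
Proof.
move=> /(dist_ge0 x) dC /(dist_ge0 x) dD; rewrite /max_dist !big_cons big_nil.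
by rewrite !le_max !ge_max lexx orbT orbT /= !addr_ge0 // lerDl dD lerDr dC.
Qed.

Lemma dist_range {R : realType} {H : hilbertType R} (T : Type) (f : T -> H) t :
  dist (f t) (range f) = 0.
Proof.
apply/eqP; rewrite eq_le dist_ge0; last by exists (f t), t.
by rewrite andbT -(normr0 H) -(subrr (f t)) dist_le //; exists t.
Qed.

(** A point [A w] of [D] near [A x] lifts to a point of the preimage near [x],
    namely [x - u] for a preimage [u] of [A x - A w] of controlled norm. *)
Lemma dist_preimage_le {R : realType} {H1 H2 : hilbertType R}
    (A : {linear H1 -> H2}) (D : set H2) (C : R) : 0 < C ->
  (forall x, exists u, A u = A x /\ `|u| <= C * `|A x|) ->
  A @^-1` D !=set0 ->
  forall x, dist x (A @^-1` D) <= C * dist (A x) (range A `&` D).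
Proof.
move=> C0 lift [z Dz] x; rewrite -ler_pdivrMl //; apply: le_dist.
  by exists (A z); split=> //; exists z.
move=> _ [[w _ <-] Dw]; rewrite ler_pdivrMl //.
have [u [Au uC]] := lift (x - w).
have /dist_le : (A @^-1` D) (x - u) by rewrite /= linearB /= Au linearB /= subKr.
move=> /(_ x) /le_trans; apply.
by rewrite subKr -linearB.
Qed.

(** * Convergence of the extrapolated method *)

Section Method.
Context {R : realType} {H1 H2 : hilbertType R}.
Variables (A : {linear H1 -> H2}) (S : H1 -> H1) (T : H2 -> H2).
Variables (rhoS rhoT eps : R) (sigma : H1 -> R) (lambda : nat -> R) (x : nat -> H1).
Hypothesis A_bounded : bounded_near A (nbhs (0 : H1)).
Hypothesis A_nonzero : exists v, A v != 0.
Hypotheses (rhoS_gt0 : 0 < rhoS) (rhoT_gt0 : 0 < rhoT).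
Hypotheses (S_SQNE : SQNE rhoS S) (T_SQNE : SQNE rhoT T).
Let F := Fix S `&` A @^-1` Fix T.
Hypothesis F_nonempty : F !=set0.
Hypothesis sigma_tau : extrapolation A T sigma.
Hypothesis eps_gt0 : 0 < eps.
Hypothesis lambda_eps : forall k, eps <= lambda k <= 1.
Let s k := lambda k * (sigma (x k) / opnorm A ^+ 2).
Let v k := landweber_step A T (s k) (x k).
Hypothesis xE : forall k, x k.+1 = S (v k).
Let y k := T (A (x k)) - A (x k).

Let decrease k := rhoS * `|S (v k) - v k| ^+ 2 + rhoT * (s k * `|y k| ^+ 2).

Let op2_gt0 : 0 < opnorm A ^+ 2.
Proof. by rewrite exprn_gt0 // opnorm_gt0. Qed.

Let step_bounds k : `|v k - x k| ^+ 2 <= s k * `|y k| ^+ 2 /\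
  forall z, Fix T (A z) ->
    `|v k - z| ^+ 2 <= `|x k - z| ^+ 2 - rhoT * (s k * `|y k| ^+ 2).
Proof.
apply: landweber_step_bounds => //; have /andP[le ->] := lambda_eps k.
by rewrite andbT (le_trans (ltW eps_gt0)).
Qed.

Lemma le_eps_residual k : eps / opnorm A ^+ 2 * `|y k| ^+ 2 <= s k * `|y k| ^+ 2.
Proof.
rewrite ler_wpM2r ?sqr_ge0 // /s mulrA ler_pM2r ?invr_gt0 //.
have /andP[le _] := lambda_eps k; have /andP[s1 _] := sigma_tau (x k).
by rewrite -[eps]mulr1 ler_pM // ltW.
Qed.

Let step_ge0 k : 0 <= s k * `|y k| ^+ 2.
Proof.
apply: le_trans (le_eps_residual k).
by rewrite mulr_ge0 ?sqr_ge0 // divr_ge0 ?ltW.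
Qed.

Let decrease_ge0 k : 0 <= decrease k.
Proof. by rewrite addr_ge0 // mulr_ge0 ?sqr_ge0 // ltW. Qed.

Lemma sqr_dist_decrease k z : F z ->
  `|x k.+1 - z| ^+ 2 <= `|x k - z| ^+ 2 - decrease k.
Proof.
move=> [Sz Tz]; rewrite xE; have := S_SQNE.2 (v k) z Sz.
have := (step_bounds k).2 z Tz; rewrite /decrease; lra.
Qed.

Lemma method_fejer : fejer_monotone F x.
Proof.
move=> k z Fz; rewrite -ler_sqr ?nnegrE //.
by apply: le_trans (sqr_dist_decrease k Fz) _; rewrite gerBl.
Qed.

Lemma decrease_cvg0 : decrease @ \oo --> (0 : R).
Proof.
have [z Fz] := F_nonempty; have [a xa] := fejer_cvg_norm method_fejer Fz.
have xa2 : (fun k => `|x k - z| ^+ 2) @ \oo --> a ^+ 2.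
  by rewrite expr2; apply: cvgM.
apply: (@squeeze_cvgr _ _ _ _ (cst 0)
  (fun k => `|x k - z| ^+ 2 - `|x k.+1 - z| ^+ 2)).
- by apply: nearW => k; rewrite decrease_ge0 lerBrDr addrC -lerBrDr sqr_dist_decrease.
- exact: cvg_cst.
- rewrite -(subrr (a ^+ 2)); apply: cvgB => //.
  by rewrite (cvg_shiftS (fun k => `|x k - z| ^+ 2) (nbhs (a ^+ 2))).
Qed.

(** Since [s k >= eps / opnorm A ^+ 2], the decrease dominates the residual of
    [T]; the bound on [v k - x k] is the one kept by [landweber_step_bounds]. *)
Lemma residuals_le_decrease : exists2 c : R, 0 < c & forall k,
  [/\ `|v k - x k| ^+ 2 <= c * decrease k,
      `|S (v k) - v k| ^+ 2 <= c * decrease k &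
      `|y k| ^+ 2 <= c * decrease k].
Proof.
have a0 : 0 < rhoT^-1 by rewrite invr_gt0.
have b0 : 0 < rhoS^-1 by rewrite invr_gt0.
have d0 : 0 < (rhoT * (eps / opnorm A ^+ 2))^-1.
  by rewrite invr_gt0 mulr_gt0 // divr_gt0.
have dec_T k : rhoT * (s k * `|y k| ^+ 2) <= decrease k.
  by rewrite lerDr mulr_ge0 ?sqr_ge0 // ltW.
have dec_S k : rhoS * `|S (v k) - v k| ^+ 2 <= decrease k.
  by rewrite lerDl mulr_ge0 // ltW.
exists (rhoT^-1 + rhoS^-1 + (rhoT * (eps / opnorm A ^+ 2))^-1).
  by rewrite !addr_gt0.
move=> k; have D := decrease_ge0 k; split.
- apply: (@le_trans _ _ (rhoT^-1 * decrease k)).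
    rewrite ler_pdivlMl //; apply: le_trans (dec_T k).
    by rewrite ler_pM2l //; case: (step_bounds k).
  by rewrite ler_wpM2r // -addrA lerDl addr_ge0 // ltW.
- apply: (@le_trans _ _ (rhoS^-1 * decrease k)).
    by rewrite ler_pdivlMl.
  by rewrite ler_wpM2r // addrAC lerDr addr_ge0 // ltW.
- apply: (@le_trans _ _ ((rhoT * (eps / opnorm A ^+ 2))^-1 * decrease k)).
    rewrite ler_pdivlMl; last by rewrite -invr_gt0.
    apply: le_trans (dec_T k).
    by rewrite -mulrA ler_pM2l // le_eps_residual.
  by rewrite ler_wpM2r // lerDr addr_ge0 // ltW.
Qed.

Let sqr_le_decrease_cvg0 (V : normedModType R) (u : nat -> V) (c : R) :
  (forall k, `|u k| ^+ 2 <= c * decrease k) -> u @ \oo --> (0 : V).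
Proof.
move=> uc; apply/norm_cvg0P.
have r0 : (fun k => Num.sqrt (c * decrease k)) @ \oo --> (0 : R).
  rewrite -sqrtr0; apply: continuous_cvg; first exact: sqrt_continuous.
  by rewrite -(mulr0 c); apply: cvgMr; exact: decrease_cvg0.
apply: (squeeze_cvgr _ (cvg_cst 0) r0); apply: nearW => k.
by rewrite normr_ge0 /= -[leLHS]normr_id -sqrtr_sqr ler_wsqrtr.
Qed.

Lemma residuals_cvg0 :
  [/\ (fun k => v k - x k) @ \oo --> (0 : H1),
      (fun k => S (v k) - v k) @ \oo --> (0 : H1) & y @ \oo --> (0 : H2)].
Proof.
have [c _ cP] := residuals_le_decrease.
by split; apply: (sqr_le_decrease_cvg0 (c := c)) => k; case: (cP k).
Qed.

(** The sequences [x], [v] have the same weak cluster points, and [A \o x] has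
    their images, because [A] is weakly continuous. *)
Lemma method_weak_cvg : weakly_regular S -> weakly_regular T ->
  exists2 xoo, F xoo & weakly_cvg x xoo.
Proof.
move=> Sreg Treg; have [vx0 Sv0 y0] := residuals_cvg0.
apply: (fejer_weak_cvg F_nonempty method_fejer) => n l n_incr xl; split.
  apply: (Sreg v n l n_incr) => // w.
  have nat_incr_oo : n @ \oo --> \oo.
    exact: increasing_seq_cvg_infty.
  rewrite (_ : (fun k => _) = fun k => inner ((x \o n) k) w
      + inner (v (n k) - x (n k)) w).
    rewrite -[X in _ --> X]addr0 -[X in _ --> _ + X](inner0l w).
    apply: cvgD => //; apply: norm_cvg_inner.
    exact: (cvg_comp _ _ nat_incr_oo vx0).
  by apply/funext => k; rewrite /= innerBl addrC subrK.
apply: (Treg (A \o x) n (A l) n_incr) => // w.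
rewrite (_ : (fun k => _) = fun k => inner ((x \o n) k) (adjoint A w)).
  by rewrite adjointP.
by apply/funext => k; rewrite /= adjointP.
Qed.

Let Fix_S_nonempty : Fix S !=set0 := S_SQNE.1.
Let Fix_T_nonempty : Fix T !=set0 := T_SQNE.1.
Let preimage_nonempty : A @^-1` Fix T !=set0.
Proof. by have [z [_ Tz]] := F_nonempty; exists z. Qed.
Let range_nonempty : range A !=set0.
Proof. by exists (A 0), 0. Qed.

Lemma closed_solutions : closed F.
Proof.
apply: closedI; first exact: closed_Fix_SQNE S_SQNE.
apply: preimage_closed; last exact: closed_Fix_SQNE T_SQNE.
by move=> z _; exact: bounded_linear_continuous.
Qed.

Let bounded_iterates : exists c,
  [/\ forall k, `|x k| <= c, forall k, `|v k| <= c & forall k, `|A (x k)| <= c].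
Proof.
have [c xc] := fejer_bounded F_nonempty method_fejer.
have [z [Sz Tz]] := F_nonempty.
have c0 : 0 <= c := le_trans (normr_ge0 _) (xc 0%N).
(* the sum of the bounds of the three sequences *)
exists (c + (c + `|z| + `|z|) + opnorm A * c).
have O0 : 0 <= opnorm A * c by rewrite mulr_ge0 // opnorm_ge0.
have z0 : 0 <= `|z| by [].
split=> k.
- by have := xc k; lra.
- have : `|v k - z| <= `|x k - z|.
    rewrite -ler_sqr ?nnegrE //; apply: le_trans ((step_bounds k).2 z Tz) _.
    by rewrite gerBl mulr_ge0 // ltW.
  have := ler_normB (x k) z; have := ler_normD (v k - z) z; rewrite subrK.
  by have := xc k; lra.
- have : opnorm A * `|x k| <= opnorm A * c by rewrite ler_wpM2l // opnorm_ge0.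
  by have := le_opnorm A_bounded (x k); lra.
Qed.

Lemma method_strong_cvg : closed (range A) ->
  boundedly_regular S -> boundedly_regular T ->
  family_boundedly_regular [:: range A; Fix T] ->
  family_boundedly_regular [:: Fix S; A @^-1` Fix T] ->
  exists xoo, [/\ F xoo, weakly_cvg x xoo & x @ \oo --> xoo].
Proof.
move=> Acl Sreg Treg ATreg STreg; have [vx0 Sv0 y0] := residuals_cvg0.
have [c [xc vc Axc]] := bounded_iterates.
have dTx : (fun k => dist (A (x k)) (Fix T)) @ \oo --> (0 : R).
  by apply: (Treg (A \o x)); [exact: bounded_fun_le Axc|apply/norm_cvg0P].
have dSv : (fun k => dist (v k) (Fix S)) @ \oo --> (0 : R).
  by apply: (Sreg v); [exact: bounded_fun_le vc|apply/norm_cvg0P].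
have dSx : (fun k => dist (x k) (Fix S)) @ \oo --> (0 : R).
  have up : (fun k => `|v k - x k| + dist (v k) (Fix S)) @ \oo --> (0 : R).
    by rewrite -[X in _ --> X]addr0; apply: cvgD => //; apply/norm_cvg0P.
  apply: (squeeze_cvgr _ (cvg_cst 0) up); apply: nearW => k.
  by rewrite dist_ge0 //= distrC dist_le_shift.
have [C C0 lift] := closed_range_bounded_preimage A_bounded Acl.
have dAT : (fun k => dist (A (x k)) (range A `&` Fix T)) @ \oo --> (0 : R).
  rewrite -family_inter2; apply: (ATreg (A \o x)); first exact: bounded_fun_le Axc.
  apply: (squeeze_cvgr _ (cvg_cst 0) dTx); apply: nearW => k.
  have := max_dist2_bounds (A (x k)) range_nonempty Fix_T_nonempty.
  by rewrite dist_range add0r.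
have dpre : (fun k => dist (x k) (A @^-1` Fix T)) @ \oo --> (0 : R).
  have up : (fun k => C * dist (A (x k)) (range A `&` Fix T)) @ \oo --> (0 : R).
    by rewrite -(mulr0 C); apply: cvgMr.
  apply: (squeeze_cvgr _ (cvg_cst 0) up); apply: nearW => k.
  by rewrite dist_ge0 //= dist_preimage_le.
have dF : (fun k => dist (x k) F) @ \oo --> (0 : R).
  rewrite /F -family_inter2; apply: STreg; first exact: bounded_fun_le xc.
  have up : (fun k => dist (x k) (Fix S) + dist (x k) (A @^-1` Fix T))
      @ \oo --> (0 : R).
    by rewrite -[X in _ --> X]addr0; apply: cvgD.
  apply: (squeeze_cvgr _ (cvg_cst 0) up); apply: nearW => k.
  exact: max_dist2_bounds.
have [l [Fl xl _]] := fejer_strong_cvg F_nonempty method_fejer closed_solutions dF.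
by exists l; split => //; exact: cvg_weakly_cvg.
Qed.

(** [x k] is near [Fix S] because [v k] is, and near the preimage of [Fix T]
    because [A (x k)] belongs to [range A] and is near [Fix T]. Each of the four
    regularity constants makes one of these passages linear in the residuals,
    so the square of the distance to [F] is linear in the decrease. *)
Lemma dist_le_decrease : closed (range A) ->
  boundedly_linearly_regular S -> boundedly_linearly_regular T ->
  family_boundedly_linearly_regular [:: range A; Fix T] ->
  family_boundedly_linearly_regular [:: Fix S; A @^-1` Fix T] ->
  exists2 K : R, 0 < K & forall k, dist (x k) F ^+ 2 <= K * decrease k.
Proof.
move=> Acl Sreg Treg ATreg STreg.
have [b [xb vb Axb]] := bounded_iterates.
have [dS dS0 dSP] := Sreg _ (bounded_set_range vb).
have [dT dT0 dTP] := Treg _ (bounded_set_range Axb).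
have [k1 k10 k1P] := ATreg _ (bounded_set_range Axb).
have [k2 k20 k2P] := STreg _ (bounded_set_range xb).
have [C C0 lift] := closed_range_bounded_preimage A_bounded Acl.
have [c c0 cP] := residuals_le_decrease.
pose p := C * (k1 / dT).
have p0 : 0 < p by rewrite mulr_gt0 // divr_gt0.
have dist_bound k : dist (x k) F <=
    k2 * (`|v k - x k| + dS^-1 * `|S (v k) - v k| + p * `|y k|).
  have := k2P (x k) (imageT x k); rewrite family_inter2 => /le_trans; apply.
  rewrite ler_pM2l //.
  have /andP[_ /le_trans] := max_dist2_bounds (x k) Fix_S_nonempty preimage_nonempty.
  apply; apply: lerD.
    apply: le_trans (dist_le_shift (x k) (v k) Fix_S_nonempty) _.
    by rewrite distrC lerD2l ler_pdivlMl // dSP //; exists k.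
  apply: le_trans (dist_preimage_le C0 lift preimage_nonempty _) _.
  rewrite /p -mulrA ler_pM2l //.
  have := k1P (A (x k)) (imageT (A \o x) k).
  rewrite family_inter2 => /le_trans; apply.
  rewrite -mulrA ler_pM2l // ler_pdivlMl //.
  have /andP[_] := max_dist2_bounds (A (x k)) range_nonempty Fix_T_nonempty.
  rewrite dist_range add0r => le_max.
  apply: le_trans (dTP (A (x k)) (imageT (A \o x) k)).
  by rewrite ler_pM2l.
pose L := k2 * (1 + dS^-1 + p).
have dSi0 : 0 < dS^-1 by rewrite invr_gt0.
have L0 : 0 < L by rewrite mulr_gt0 // !addr_gt0.
exists (L ^+ 2 * c); first by rewrite mulr_gt0 // exprn_gt0.
move=> k; have [h1 h2 h3] := cP k; have D0 := decrease_ge0 k.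
pose r := Num.sqrt (c * decrease k).
have le_r (u : R) : 0 <= u -> u ^+ 2 <= c * decrease k -> u <= r.
  by move=> u0 uc; rewrite -[u]ger0_norm // -sqrtr_sqr ler_wsqrtr.
have : dist (x k) F <= L * r.
  apply: le_trans (dist_bound k) _; rewrite /L -mulrA ler_pM2l //.
  rewrite !mulrDl mul1r !lerD // ?ler_pM2l //; exact: le_r.
have r0 : 0 <= r by rewrite sqrtr_ge0.
rewrite -ler_sqr ?nnegrE ?dist_ge0 ?(mulr_ge0 (ltW L0)) // => /le_trans; apply.
by rewrite exprMn sqr_sqrtr ?mulrA // mulr_ge0 // ltW.
Qed.

(** With [sqr_dist_decrease], [dist_le_decrease] contracts the squared distance
    by the factor [1 - 1 / (K + 1)]. *)
Lemma method_linear_cvg : closed (range A) ->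
  boundedly_linearly_regular S -> boundedly_linearly_regular T ->
  family_boundedly_linearly_regular [:: range A; Fix T] ->
  family_boundedly_linearly_regular [:: Fix S; A @^-1` Fix T] ->
  exists xoo, [/\ F xoo, weakly_cvg x xoo &
    exists2 q : R, 0 < q < 1 &
      forall k, dist (x k.+1) F <= q * dist (x k) F /\
                `|x k - xoo| <= 2 * dist (x 0%N) F * q ^+ k].
Proof.
move=> Acl Sreg Treg ATreg STreg.
have [K K0 KP] := dist_le_decrease Acl Sreg Treg ATreg STreg.
(* enlarging [K] keeps [1 - 1 / (K + 1)] positive *)
have K1 : 0 < K + 1 by rewrite addr_gt0.
pose q := Num.sqrt (1 - (K + 1)^-1).
have t01 : 0 < 1 - (K + 1)^-1 < 1.
  by rewrite subr_gt0 invf_lt1 // ltrDr K0 gtrBl invr_gt0.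
have /andP[t0 t1] := t01.
have q01 : 0 < q < 1.
  by rewrite sqrtr_gt0 t0 /= -[X in _ < X]sqrtr1 ltr_sqrt.
have /andP[q0 q1] := q01.
have contract k : dist (x k.+1) F <= q * dist (x k) F.
  have dk := dist_ge0 (x k) F_nonempty; have dk1 := dist_ge0 (x k.+1) F_nonempty.
  have D := decrease_ge0 k.
  rewrite -ler_sqr ?nnegrE ?mulr_ge0 ?(ltW q0) // exprMn sqr_sqrtr ?(ltW t0) //.
  apply: le_trans (sqr_dist_le_sub F_nonempty D (fun z => @sqr_dist_decrease k z)) _.
  rewrite mulrBl mul1r lerD2l lerN2 ler_pdivrMl //.
  by have := KP k; lra.
have geom k : dist (x k) F <= dist (x 0%N) F * q ^+ k.
  elim: k => [|k IH]; first by rewrite expr0 mulr1.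
  apply: le_trans (contract k) _.
  by rewrite exprS mulrCA ler_pM2l.
have dF : (fun k => dist (x k) F) @ \oo --> (0 : R).
  have up : (fun k => dist (x 0%N) F * q ^+ k) @ \oo --> (0 : R).
    rewrite -(mulr0 (dist (x 0%N) F)); apply: cvgMr.
    by apply: cvg_expr; rewrite ger0_norm // ltW.
  apply: (squeeze_cvgr _ (cvg_cst 0) up); apply: nearW => k.
  by rewrite dist_ge0 //= geom.
have [l [Fl xl xkl]] := fejer_strong_cvg F_nonempty method_fejer closed_solutions dF.
exists l; split => //; first exact: cvg_weakly_cvg.
exists q => // k; split; first exact: contract.
by apply: le_trans (xkl k) _; rewrite -mulrA ler_pM2l.
Qed.

End Method.

(** * The convergence theorem *)

Theorem theorem6p1 (R : realType) (H1 H2 : hilbertType R)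
    (A : {linear H1 -> H2}) (S : H1 -> H1) (T : H2 -> H2) (rhoS rhoT : R)
    (A_bounded : bounded_near A (nbhs (0 : H1)))
    (A_nonzero : exists v, A v != 0)
    (rhoS_gt0 : 0 < rhoS) (rhoT_gt0 : 0 < rhoT)
    (S_SQNE : SQNE rhoS S) (T_SQNE : SQNE rhoT T)
    (F_nonempty : Fix S `&` A @^-1` Fix T !=set0) :
  let F := Fix S `&` A @^-1` Fix T in
  (extrapolation A T (fun=> 1) /\ extrapolation A T (tau A T)) /\
  forall (sigma : H1 -> R) (eps : R) (lambda : nat -> R) (x : nat -> H1),
    extrapolation A T sigma ->
    0 < eps < 1 ->
    (forall k, eps <= lambda k <= 1) ->
    (forall k, x k.+1 =
       S (x k + (lambda k * (sigma (x k) / opnorm A ^+ 2))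
                  *: adjoint A (T (A (x k)) - A (x k)))) ->
    [/\ weakly_regular S -> weakly_regular T ->
          exists2 xoo, F xoo & weakly_cvg x xoo,
        closed (range A) ->
        boundedly_regular S -> boundedly_regular T ->
        family_boundedly_regular [:: range A; Fix T] ->
        family_boundedly_regular [:: Fix S; A @^-1` Fix T] ->
          exists xoo, [/\ F xoo, weakly_cvg x xoo & x @ \oo --> xoo] &
        closed (range A) ->
        boundedly_linearly_regular S -> boundedly_linearly_regular T ->
        family_boundedly_linearly_regular [:: range A; Fix T] ->
        family_boundedly_linearly_regular [:: Fix S; A @^-1` Fix T] ->
          exists xoo, [/\ F xoo, weakly_cvg x xoo &
            exists2 q : R, 0 < q < 1 &
              forall k, dist (x k.+1) F <= q * dist (x k) F /\
                        `|x k - xoo| <= 2 * dist (x 0%N) F * q ^+ k]].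

Proof.
move=> F; have [z [Sz Tz]] := F_nonempty; split.
  by split=> w; rewrite lexx (tau_ge1 A_bounded rhoT_gt0 T_SQNE _ Tz).
move=> sigma eps lambda x sigma_tau /andP[eps_gt0 _] lambda_eps xE; split.
- exact: (method_weak_cvg A_bounded A_nonzero rhoS_gt0 rhoT_gt0 S_SQNE T_SQNE
    F_nonempty sigma_tau eps_gt0 lambda_eps xE).
- exact: (method_strong_cvg A_bounded A_nonzero rhoS_gt0 rhoT_gt0 S_SQNE T_SQNE
    F_nonempty sigma_tau eps_gt0 lambda_eps xE).
- exact: (method_linear_cvg A_bounded A_nonzero rhoS_gt0 rhoT_gt0 S_SQNE T_SQNE
    F_nonempty sigma_tau eps_gt0 lambda_eps xE).
Qed.
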